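(* Let $n\ge1$ and $N=2^n$. Let $\rho$ and $\sigma$ be full-rank density matrices on $\mathbb{C}^N$, each having nondegenerate eigenvalues (i.e. $N$ distinct eigenvalues), and suppose the eigenvectors of $\rho$ and $\sigma$ are mutually nonorthogonal: $\langle x|y\rangle\neq0$ for every eigenvector $|x\rangle$ of $\rho$ and every eigenvector $|y\rangle$ of $\sigma$. If a unitary $W$ on $\mathbb{C}^N$ satisfies $W\rho W^\dagger=\rho$ and $W\sigma W^\dagger=\sigma$, then $W$ is the identity up to a global phase, i.e. $W=e^{i\theta}I$ for some $\theta\in\mathbb{R}$.
   Context: A density matrix is a positive semidefinite matrix of trace one. *)

(* Defs.v *)
From HB Require Import structures.
From mathcomp Require Export all_boot all_order all_algebra.
From mathcomp Require Export sesquilinear spectral.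
From mathcomp Require Export reals trigo.
From mathcomp Require Export complex.

Set Implicit Arguments.
Unset Strict Implicit.
Unset Printing Implicit Defensive.

Import Order.TTheory GRing.Theory Num.Theory.
Local Open Scope ring_scope.
Local Open Scope sesquilinear_scope.
Local Open Scope complex_scope.

(* Kets are column vectors; [braket] is conjugate-linear in its first
   argument, unlike [dotmx], which pairs row vectors. *)
Definition braket (R : realType) (N : nat) (x y : 'cV[R[i]]_N) : R[i] :=
  (x ^t* *m y) 0 0.

(* The order on R[i] is partial: [0 <= z] says that z is real and nonnegative. *)
Definition psdmx (R : realType) (N : nat) (A : 'M[R[i]]_N) : Prop :=
  A \is hermsymmx /\ forall x : 'cV[R[i]]_N, 0 <= braket x (A *m x).

Definition density_matrix (R : realType) (N : nat) (A : 'M[R[i]]_N) : Prop :=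
  psdmx A /\ \tr A = 1.

Definition eigenvector (R : realType) (N : nat) (A : 'M[R[i]]_N)
    (x : 'cV[R[i]]_N) : Prop :=
  x != 0 /\ exists a : R[i], A *m x = a *: x.

(* The library's [eigenvalue] is phrased with row vectors;
   [eigenvalue_colP] below shows that columns give the same eigenvalues. *)
Definition nondegenerate_spectrum (R : realType) (N : nat)
    (A : 'M[R[i]]_N) : Prop :=
  exists s : seq R[i], [/\ uniq s, size s = N & {in s, forall a, eigenvalue A a}].

Lemma eigenvalue_colP (R : realType) (N : nat) (A : 'M[R[i]]_N) (a : R[i]) :
  eigenvalue A a <-> exists2 x : 'cV[R[i]]_N, x != 0 & A *m x = a *: x.
Proof.
have -> : eigenvalue A a = eigenvalue A^T a.
  rewrite !eigenvalue_root_char; congr (root _ a).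
  rewrite /char_poly -det_tr; congr (\det _).
  by rewrite /char_poly_mx linearB /= tr_scalar_mx map_trmx.
split=> [/eigenvalueP[v vA v0]|[x x0 Ax]].
  exists v^T; first by rewrite -(inj_eq trmx_inj) trmxK trmx0.
  by apply: trmx_inj; rewrite trmx_mul trmxK vA linearZ /= trmxK.
apply/eigenvalueP; exists x^T; first by rewrite -trmx_mul Ax linearZ.
by rewrite -(inj_eq trmx_inj) trmxK trmx0.
Qed.

(* e^{i theta}, by Euler's formula. *)
Definition expi (R : realType) (theta : R) : R[i] := cos theta +i* sin theta.

(* Main.v *)
(* [W] commutes with [rho] and [sigma], whose eigenspaces are lines, so every
   eigenvector of either matrix is an eigenvector of [W]. Comparing the two ways
   of computing <x|W|y> for eigenvectors x of [rho] and y of [sigma], with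
   <x|y> nonzero, shows that the eigenvalue of [W] at x is the one at y, hence
   does not depend on x. As the eigenvectors of [rho] span the space, [W] is
   scalar, and unitarity makes the scalar a phase. *)
Require Import Defs.
From mathcomp Require Import all_boot all_order all_algebra.
From mathcomp Require Import sesquilinear spectral reals trigo complex.

Import Order.TTheory GRing.Theory Num.Theory.
Local Open Scope ring_scope.
Local Open Scope sesquilinear_scope.
Local Open Scope complex_scope.

Set Implicit Arguments.
Unset Strict Implicit.

(* A dimension count: [n] independent nonzero eigenspaces in dimension [n]
   must be lines that fill the space. *)
Lemma simple_spectrum_eigenspace (F : fieldType) (n : nat) (A : 'M[F]_n)
    (s : seq F) :
    uniq s -> size s = n -> {in s, forall a, eigenvalue A a} ->
  (\sum_(i < n) eigenspace A s`_i :=: 1%:M)%MS /\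
  {in s, forall a, \rank (eigenspace A a) = 1%N}.
Proof.
move=> s_uniq s_size s_eig.
have dx : mxdirect (\sum_(i < n) eigenspace A s`_i)%MS.
  apply: mxdirect_sum_eigenspace => i j _ _ /eqP.
  by rewrite nth_uniq ?s_size // => /eqP /val_inj.
have rk_gt0 (i : 'I_n) : (0 < \rank (eigenspace A s`_i))%N.
  by rewrite lt0n mxrank_eq0; apply: s_eig; rewrite mem_nth ?s_size.
have rk_le : (\sum_(i < n) \rank (eigenspace A s`_i) <= \sum_(i < n) 1)%N.
  by rewrite -(mxdirectP dx) /= sum1_card card_ord rank_leq_col.
have rk1 (i : 'I_n) : \rank (eigenspace A s`_i) = 1%N.
  (* Each rank is at least 1 while their sum is at most [n], so the equality case of the termwise
     bound forces every rank to be 1. *)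
  have [_] := leqif_sum (fun j (_ : xpredT j) => leqif_eq (rk_gt0 j)).
  by rewrite eqn_leq rk_le leq_sum // => /esym /forallP /(_ i) /eqP.
split; last first.
  move=> a sa; have ia : (index a s < n)%N by rewrite -s_size index_mem.
  by rewrite -[in LHS](nth_index 0 sa); apply: (rk1 (Ordinal ia)).
apply/eqmxP; rewrite submx1 sub1mx /row_full (mxdirectP dx) /=.
by rewrite (eq_bigr _ (fun i _ => rk1 i)) sum1_card card_ord.
Qed.

(** [B] maps the eigenspace of [A] into itself, and this eigenspace is the line spanned by [v]. *)
Lemma comm_mx_eigenline (F : fieldType) (n : nat) (A B : 'M[F]_n) (a : F)
    (v : 'rV[F]_n) :
    comm_mx A B -> \rank (eigenspace A a) = 1%N -> v != 0 ->
    v *m A = a *: v ->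
  exists l, v *m B = l *: v.
Proof.
move=> AB rk1 v0 vA; apply/sub_rVP.
have vE : (v <= eigenspace A a)%MS by apply/eigenspaceP.
have /eqmxP-> : (v == eigenspace A a)%MS.
  by rewrite -(geq_leqif (mxrank_leqif_eq vE)) rk1 lt0n mxrank_eq0.
by apply/eigenspaceP; rewrite -mulmxA -AB mulmxA vA scalemxAl.
Qed.

(** Bridges the row vectors of [eigenspace] and the column vectors of [eigenvector]: taking adjoints
    in [v *m A = a *: v] fixes [A] and conjugates [a]. *)
Lemma hermsymmx_eigenvector (R : realType) (N : nat) (A : 'M[R[i]]_N)
    (a : R[i]) (v : 'rV[R[i]]_N) :
  A \is hermsymmx -> v != 0 -> v *m A = a *: v -> eigenvector A (v ^t*).
Proof.
move=> /is_hermitianmxP; rewrite expr0 scale1r => A_herm v0 vA; split.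
  by rewrite map_mx_eq0 trmx_eq0.
exists (a^*)%C; rewrite {1}A_herm -map_mxM -trmx_mul vA linearZ /=.
by rewrite map_mxZ.
Qed.

Lemma unitarymx_comm (R : realType) (N : nat) (A W : 'M[R[i]]_N) :
    W \is unitarymx -> W *m A *m W ^t* = A ->
  comm_mx A W /\ comm_mx A (W ^t*).
Proof.
move=> WU WA; have WtW : W ^t* *m W = 1%:M by apply: mulmx1C; apply/unitarymxP.
split; rewrite /comm_mx.
  by rewrite -{1}WA -mulmxA WtW mulmx1.
by rewrite -{2}WA !mulmxA WtW mul1mx.
Qed.

Lemma normc1_expi (R : realType) (z : R[i]) :
  `|z| = 1 -> exists theta : R, z = expi theta.
Proof.
case: z => x y; rewrite normc_def => /complexI /= sqrt1.
have xy1 : x ^+ 2 + y ^+ 2 = 1.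
  by rewrite -[LHS]sqr_sqrtr ?addr_ge0 ?sqr_ge0 // sqrt1 expr1n.
have x_le1 : -1 <= x <= 1.
  by rewrite -ler_norml -sqrtr_sqr -[leRHS]sqrtr1 ler_wsqrtr // -xy1 lerDl sqr_ge0.
have sin_x : sin (acos x) = `|y|.
  by rewrite sin_acos // -xy1 addrC addKr sqrtr_sqr.
have cos_x : cos (acos x) = x by rewrite acosK // in_itv.
(* [acos] only reaches the upper half circle; the lower half needs the opposite angle. *)
have [y0|y0] := leP 0 y.
  by exists (acos x); rewrite /expi cos_x sin_x ger0_norm.
by exists (- acos x); rewrite /expi cosN sinN cos_x sin_x ltr0_norm ?opprK.
Qed.

Unset Implicit Arguments.

Theorem proposition3 (R : realType) (n : nat) (n_ge1 : (1 <= n)%N)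
    (rho sigma W : 'M[R[i]]_(2 ^ n)%N)
    (rho_density : density_matrix rho) (sigma_density : density_matrix sigma)
    (rho_full_rank : \rank rho = (2 ^ n)%N)
    (sigma_full_rank : \rank sigma = (2 ^ n)%N)
    (rho_nondegenerate : nondegenerate_spectrum rho)
    (sigma_nondegenerate : nondegenerate_spectrum sigma)
    (nonorthogonal : forall x y : 'cV[R[i]]_(2 ^ n)%N,
       eigenvector rho x -> eigenvector sigma y -> braket x y != 0)
    (W_unitary : W \is unitarymx)
    (W_rho : W *m rho *m W ^t* = rho)
    (W_sigma : W *m sigma *m W ^t* = sigma) :
  exists theta : R, W = (expi theta)%:M.
Proof.
have [s [s_uniq s_size s_eig]] := rho_nondegenerate.
have [t [t_uniq t_size t_eig]] := sigma_nondegenerate.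
have [s_full s_rk] := simple_spectrum_eigenspace s_uniq s_size s_eig.
have [_ t_rk] := simple_spectrum_eigenspace t_uniq t_size t_eig.
have [rhoW _] := unitarymx_comm W_unitary W_rho.
have [_ sigmaWt] := unitarymx_comm W_unitary W_sigma.
(* A single eigenvector of [sigma] suffices as reference; [t] is nonempty because [2 ^ n] is
   positive. *)
have tb : t`_0 \in t by rewrite mem_nth // t_size expn_gt0.
have /eigenvalueP[w wb w0] := t_eig _ tb.
have [nu wWt] := comm_mx_eigenline sigmaWt (t_rk _ tb) w0 wb.
(* The adjoint of [w *m W ^t* = nu *: w] makes the column [w ^t*] an eigenvector of [W] for the
   conjugate of [nu]. *)
pose mu := Num.conj nu.
have Ww : W *m w ^t* = mu *: w ^t*.
  by rewrite -[in LHS](trmxCK W) -map_mxM -trmx_mul wWt linearZ map_mxZ.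
have W_line a (v : 'rV_(2 ^ n)) : a \in s -> v *m rho = a *: v ->
    v *m W = mu *: v.
  move=> sa va; have [->|v0] := eqVneq v 0; first by rewrite mul0mx scaler0.
  have [l vW] := comm_mx_eigenline rhoW (s_rk _ sa) v0 va.
  have := nonorthogonal _ _
    (hermsymmx_eigenvector rho_density.1.1 v0 va)
    (hermsymmx_eigenvector sigma_density.1.1 w0 wb).
  rewrite /braket trmxCK => vw0; suff -> : mu = l by [].
  (* [W] acts on [w ^t*] to its right or on [v] to its left; the nonzero overlap then cancels. *)
  have /rowP/(_ 0) : mu *: (v *m w ^t*) = l *: (v *m w ^t*).
    by rewrite scalemxAr -Ww mulmxA vW scalemxAl.
  by rewrite [LHS]mxE [RHS]mxE => /(mulIf vw0).
have W_mu : W = mu%:M.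
  have : (1%:M <= eigenspace W mu)%MS.
    rewrite -s_full; apply/sumsmx_subP => i _; apply/rV_subP => v /eigenspaceP v_eig.
    by apply/eigenspaceP/(W_line _ _ _ v_eig); rewrite mem_nth ?s_size.
  by move=> /eigenspaceP; rewrite mul1mx scalemx1.
have [|theta mu_theta] := @normc1_expi R mu; last first.
  by exists theta; rewrite W_mu mu_theta.
apply/eqP; rewrite -(@pexpr_eq1 _ _ 2) // normCK.
(* Any diagonal entry of [W *m W ^t* = 1%:M] now says that [mu] times its conjugate is 1. *)
have /unitarymxP/matrixP := W_unitary.
have N_gt0 : (0 < 2 ^ n)%N by rewrite expn_gt0.
move=> /(_ (Ordinal N_gt0) (Ordinal N_gt0)).
by rewrite W_mu tr_scalar_mx map_scalar_mx -scalar_mxM !mxE eqxx => /eqP.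
Qed.
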